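(* Let $\overline{A}=(A_1,\dots,A_X)$ and $\overline{C}=(C_1,\dots,C_Z)$ be cardinalities with spaces $\mathcal{A},\mathcal{C}$, and let $\Lambda:\mathcal{A}\to\mathcal{C}$ be a left invertible deterministic local map. Then there are a cardinality $\overline{B}$ with space $\mathcal{B}$ and deterministic local maps $\Lambda^{\mathrm L}:\mathcal{A}\to\mathcal{B}$ and $\Lambda^{\mathrm R}:\mathcal{B}\to\mathcal{C}$ such that $\Lambda=\Lambda^{\mathrm R}\circ\Lambda^{\mathrm L}$, where: (i) $\Lambda^{\mathrm L}$ has the elongated block diagonal form $$\Lambda^{\mathrm L}=\left(\begin{array}{c|c|c}L_{11}&0&\cdots\\\hline L_{21}&0&\\\hline\vdots&0&\\\hline0&L_{12}&\\\hline0&L_{22}&\\\hline0&\vdots&\end{array}\right),$$ that is, for each $x\in\{1,\dots,X\}$ there is an integer $n_x\ge1$ such that the block rows (inputs of $\mathcal{B}$) are listed as $(1,1),\dots,(n_1,1),(1,2),\dots,(n_2,2),\dots$, the block in block row $(i,x)$ and block column $x$ is $L_{ix}$ and all other blocks are zero; each $L_{ix}$ is a column-stochastic deterministic matrix, and the first block $L_{1x}$ of each block column is left invertible; (ii) $\Lambda^{\mathrm R}$ is a reordering/relabeling of inputs that does not transform outputs.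
   Context: A cardinality $\overline{A}=(A_1,\dots,A_X)$ is a finite nonempty sequence of positive integers: a device has inputs $x\in\{1,\dots,X\}$ and, for input $x$, outputs $a\in\{1,\dots,A_x\}$. The associated space is $\mathcal{A}=\mathbb{R}^{A_1}\oplus\dots\oplus\mathbb{R}^{A_X}$ with coordinates indexed by pairs $(a,x)$. A deterministic local map $\mathcal{A}\to\mathcal{C}$ is determined by an input mapping $\xi:\{1,\dots,Z\}\to\{1,\dots,X\}$ and output mappings $\alpha_z:\{1,\dots,A_{\xi(z)}\}\to\{1,\dots,C_z\}$; its matrix has entry $\Lambda_{(c,z),(a,x)}=1$ if $x=\xi(z)$ and $c=\alpha_z(a)$, and $0$ otherwise. It is written as a block matrix with block rows indexed by target inputs $z$, block columns indexed by source inputs $x$, and blocks of size $C_z\times A_x$. A deterministic local map $\Lambda:\mathcal{A}\to\mathcal{C}$ is left invertible if there is a deterministic local map $\Lambda':\mathcal{C}\to\mathcal{A}$ with $\Lambda'\circ\Lambda=\mathrm{id}_{\mathcal A}$. A column-stochastic deterministic matrix is a (not necessarily square) $0/1$ matrix with exactly one entry equal to $1$ in each column; it is left invertible if it has a left inverse that is column-stochastic, equivalently if each row has at most one entry $1$. A reordering/relabeling of inputs that does not transform outputs is a deterministic local map whose input mapping is a bijection and all of whose output mappings are identity maps. *)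

(* Defs.v *)
From mathcomp Require Import all_boot all_order all_algebra reals.

Set Implicit Arguments.
Unset Strict Implicit.
Unset Printing Implicit Defensive.

Import GRing.Theory.

Local Open Scope ring_scope.

(* Inputs and outputs are numbered from 0: ['I_(inputs A)], ['I_(A x)]. *)
Record cardinality := Cardinality {
  inputs : nat;
  outputs :> 'I_inputs -> nat;
  inputs_gt0 : (0 < inputs)%N;
  outputs_gt0 : forall x, (0 < outputs x)%N
}.

(* The dimension of the direct sum of the R^(A x); its coordinates (a, x) are
   listed block by block, as [\mxblock] and [submxblock] do. *)
Definition dim (A : cardinality) : nat := (\sum_x A x)%N.

Record dlmap (A C : cardinality) := DLMap {
  input_map : 'I_(inputs C) -> 'I_(inputs A);
  output_map : forall z, 'I_(A (input_map z)) -> 'I_(C z)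
}.
Arguments output_map {A C} _ z _.

(* The cast transports a : 'I_(A x) along x = input_map L z. *)
Definition dlmap_entry (A C : cardinality) (L : dlmap A C)
    (z : 'I_(inputs C)) (c : 'I_(C z)) (x : 'I_(inputs A)) (a : 'I_(A x)) :
    bool :=
  match x =P input_map L z with
  | ReflectT e => c == output_map L z (cast_ord (congr1 A e) a)
  | ReflectF _ => false
  end.

Definition dlmap_mx (R : realType) (A C : cardinality) (L : dlmap A C) :
    'M[R]_(dim C, dim A) :=
  \mxblock_(z, x) \matrix_(c < C z, a < A x) (dlmap_entry L c a)%:R.

Definition dlmap_left_invertible (R : realType) (A C : cardinality)
    (L : dlmap A C) : Prop :=
  exists L' : dlmap C A, dlmap_mx R L' *m dlmap_mx R L = 1%:M.

Definition col_stochastic_det (R : realType) (m n : nat) (M : 'M[R]_(m, n)) :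
    Prop :=
  (forall i j, M i j = 0 \/ M i j = 1) /\
  (forall j, exists! i, M i j = 1).

Definition col_stochastic_det_left_invertible (R : realType) (m n : nat)
    (M : 'M[R]_(m, n)) : Prop :=
  exists N : 'M[R]_(n, m), col_stochastic_det N /\ N *m M = 1%:M.

(* [tagnat.Rank x i] is the position of the pair (i, x) in the list
   (0, 0), ..., (n 0 - 1, 0), (0, 1), ..., (n 1 - 1, 1), ... *)
Definition elongated_block_diag (R : realType) (A B : cardinality)
    (M : 'M[R]_(dim B, dim A)) : Prop :=
  exists (n : 'I_(inputs A) -> nat) (e : (\sum_x n x)%N = inputs B),
    (forall x, (0 < n x)%N) /\
    forall (x : 'I_(inputs A)) (i : 'I_(n x)),
      let k := cast_ord e (tagnat.Rank x i) in
      [/\ col_stochastic_det (submxblock M k x),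
          forall x', x' != x -> submxblock M k x' = 0
        & val i = 0%N ->
            col_stochastic_det_left_invertible (submxblock M k x)].

(* An identity output mapping presupposes equal numbers of outputs, so the
   equality is part of the condition. *)
Definition relabels_inputs (B C : cardinality) (L : dlmap B C) : Prop :=
  bijective (input_map L) /\
  forall z, exists e : B (input_map L z) = C z,
    forall b : 'I_(B (input_map L z)), output_map L z b = cast_ord e b.

(* Main.v *)
(* A left inverse L' of L provides a section s of the input map f of L, and
   comparing the diagonal blocks of L' L = 1 shows that the block of L in block
   row s x and block column x is left invertible.  Hence it suffices to list the
   inputs of C fibre by fibre along f, each fibre starting with s x: the
   correspondingly permuted rows of L form the left factor, and the permutation
   is the right factor. *)
Require Import Defs.
From mathcomp Require Import all_boot all_order all_algebra reals.

Set Implicit Arguments.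
Unset Strict Implicit.
Unset Printing Implicit Defensive.

Import GRing.Theory.

Local Open Scope ring_scope.

Definition dlmap_block (R : realType) (A C : cardinality) (L : dlmap A C)
    (z : 'I_(inputs C)) (x : 'I_(inputs A)) : 'M[R]_(C z, A x) :=
  \matrix_(c < C z, a < A x) (dlmap_entry L c a)%:R.

Lemma dlmap_blockE (R : realType) (A C : cardinality) (L : dlmap A C) z x :
  submxblock (dlmap_mx R L) z x = dlmap_block R L z x.
Proof. exact: mxblockK. Qed.

Lemma dlmap_entry_input_map (A C : cardinality) (L : dlmap A C) z
    (c : 'I_(C z)) (a : 'I_(A (input_map L z))) :
  dlmap_entry L c a = (c == output_map L z a).
Proof.
rewrite /dlmap_entry; case: eqP => // e.
by rewrite (eq_axiomK e) cast_ord_id.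
Qed.

Lemma dlmap_block_neq (R : realType) (A C : cardinality) (L : dlmap A C) z x :
  x != input_map L z -> dlmap_block R L z x = 0.
Proof.
move=> xz; apply/matrixP => c a; rewrite !mxE /dlmap_entry.
by case: eqP xz => // ->; rewrite eqxx.
Qed.

Lemma dlmap_block_stochastic (R : realType) (A C : cardinality) (L : dlmap A C)
    z x : x = input_map L z -> col_stochastic_det (dlmap_block R L z x).
Proof.
move=> ->; split=> [c a|a].
  by rewrite !mxE; case: dlmap_entry; [right | left].
exists (output_map L z a); split=> [|c].
  by rewrite mxE dlmap_entry_input_map eqxx.
rewrite mxE dlmap_entry_input_map; case: eqP => // _ /esym/eqP.
by rewrite oner_eq0.
Qed.

(** In block row [w] of [L] only the block in column [input_map L w] is nonzero, so the block
    product has a single surviving term. *)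
Lemma mul_dlmap_mxl (R : realType) (A C D : cardinality) (L : dlmap C D)
    (M : dlmap A C) w x :
  submxblock (dlmap_mx R L *m dlmap_mx R M) w x =
    dlmap_block R L w (input_map L w) *m dlmap_block R M (input_map L w) x.
Proof.
rewrite /dlmap_mx mul_mxblock mxblockK (bigD1 (input_map L w)) //=.
rewrite big1 ?addr0 //.
by move=> z zw; rewrite -/(dlmap_block R L w z) dlmap_block_neq ?mul0mx.
Qed.

Lemma submxblock1 (R : realType) (A : cardinality) x :
  submxblock (1%:M : 'M[R]_(Defs.dim A)) x x = 1%:M.
Proof.
apply/matrixP => a b; rewrite !mxE /=; congr (_ %:R); congr nat_of_bool.
by rewrite -val_eqE /= tagnat.eq_Rank eqxx.
Qed.

(** If [x] were not the image of [input_map L' x] under [input_map L], the only factor of [L]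
    contributing to the diagonal block at [x] would vanish, giving [0 = 1] in a matrix of size
    [A x]. *)
Lemma dlmap_section (R : realType) (A C : cardinality) (L : dlmap A C)
    (L' : dlmap C A) :
  dlmap_mx R L' *m dlmap_mx R L = 1%:M -> cancel (input_map L') (input_map L).
Proof.
move=> L'L x; apply/esym/eqP; apply: contraT => xs.
have := submxblock1 R x; rewrite -L'L mul_dlmap_mxl.
rewrite (dlmap_block_neq R xs) mulmx0 => /matrixP.
(* Positivity of [A x] matters here: an empty block would satisfy [0 = 1]. *)
pose a := Ordinal (outputs_gt0 x).
by move=> /(_ a a)/eqP; rewrite !mxE eqxx eq_sym oner_eq0.
Qed.

(** The left inverse is the block of [L'] in row [x]. The row [z] is a variable so that it can be
    instantiated by an input whose equality with [input_map L' x] is only propositional. *)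
Lemma dlmap_block_section (R : realType) (A C : cardinality) (L : dlmap A C)
    (L' : dlmap C A) x z :
  dlmap_mx R L' *m dlmap_mx R L = 1%:M -> z = input_map L' x ->
  col_stochastic_det_left_invertible (dlmap_block R L z x).
Proof.
move=> L'L ->; exists (dlmap_block R L' x (input_map L' x)); split.
  exact: dlmap_block_stochastic.
by rewrite -mul_dlmap_mxl L'L submxblock1.
Qed.

Lemma enum_fibres (T : finType) (q : nat) (f : T -> 'I_q) (s : 'I_q -> T) :
  cancel s f ->
  exists (n : 'I_q -> nat) (h : 'I_(\sum_x n x)%N -> T),
    [/\ forall x, (0 < n x)%N, bijective h,
        forall x (i : 'I_(n x)), f (h (tagnat.Rank x i)) = x
      & forall x (i : 'I_(n x)), val i = 0%N -> h (tagnat.Rank x i) = s x].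
Proof.
(* [r x] enumerates the fibre over [x] without repetition; its head [s x] makes it nonempty. *)
move=> sK; pose r x := s x :: [seq z <- enum T | (f z == x) && (z != s x)].
have mem_r x z : (z \in r x) = (f z == x).
  rewrite inE mem_filter mem_enum andbT; case: (eqVneq z (s x)) => [->|_].
    by rewrite sK eqxx.
  by rewrite andbT.
have uniq_r x : uniq (r x).
  by rewrite /= mem_filter eqxx andbF /= filter_uniq ?enum_uniq.
pose n x := size (r x); pose g x (i : 'I_(n x)) := tnth (in_tuple (r x)) i.
have fg x i : f (g x i) = x.
  by apply/eqP; rewrite -mem_r; apply: (mem_tnth i (in_tuple (r x))).
pose h (k : 'I_(\sum_x n x)%N) := g (tagnat.sig1 k) (tagnat.sig2 k).
have hRank x (i : 'I_(n x)) : h (tagnat.Rank x i) = g x i.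
  by rewrite /h /tagnat.sig1 /tagnat.sig2 /tagnat.Rank tagnat.rankK.
have h_inj : injective h.
  move=> k l; rewrite -[k]tagnat.sig2K -[l]tagnat.sig2K !hRank.
  move: (tagnat.sig1 k) (tagnat.sig2 k) (tagnat.sig1 l) (tagnat.sig2 l).
  (* Applying [f] recovers the fibre; within one fibre, positions are separated by [uniq_r]. *)
  move=> x i y j gij; have xy : x = y by rewrite -(fg x i) gij fg.
  by case: _ / xy j gij => j /(tuple_uniqP (in_tuple (r x)) (uniq_r x))->.
have f_lt z : (index z (r (f z)) < n (f z))%N by rewrite index_mem mem_r.
pose h' z := tagnat.Rank (f z) (Ordinal (f_lt z)).
have h'K : cancel h' h.
  by move=> z; rewrite hRank /g (tnth_nth z) nth_index ?mem_r.
exists n, h; split=> // [|x i|x i i0]; last 2 first.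
- by rewrite hRank fg.
- by rewrite hRank /g (tnth_nth (s x)) i0.
by exists h' => //; apply: inj_can_sym h'K h_inj.
Qed.

(** [M] is an identity matrix up to the cast along [e]. Keeping [y] and [z] as variables allows [e]
    to be eliminated, which is impossible directly for [h (h' z) = z]. *)
Lemma mul_cast_block (R : realType) (A C : cardinality) (L : dlmap A C)
    y z x (e : y = z) (M : 'M[R]_(C z, C y)) :
  (forall c b, M c b = (c == cast_ord (congr1 C e) b)%:R) ->
  M *m dlmap_block R L y x = dlmap_block R L z x.
Proof.
case: _ / e M => M M1; rewrite (_ : M = 1%:M) ?mul1mx //.
by apply/matrixP => c b; rewrite M1 mxE cast_ord_id.
Qed.

Theorem proposition22 (R : realType) (A C : cardinality) (L : dlmap A C)
    (hL : dlmap_left_invertible R L) :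
  exists (B : cardinality) (LL : dlmap A B) (LR : dlmap B C),
    [/\ dlmap_mx R L = dlmap_mx R LR *m dlmap_mx R LL,
        elongated_block_diag (dlmap_mx R LL)
      & relabels_inputs LR].
Proof.
case: hL => L' L'L.
have [n [h [n_gt0 [h' hK h'K] fh h0]]] := enum_fibres (dlmap_section L'L).
have B_gt0 : (0 < \sum_x n x)%N.
  exact: leq_ltn_trans (ltn_ord (h' (Ordinal (inputs_gt0 C)))).
pose B := @Cardinality _ (fun k => C (h k)) B_gt0 (fun k => outputs_gt0 (h k)).
pose LL := @DLMap A B (fun k => input_map L (h k))
  (fun k => output_map L (h k)).
(* Input [h' z] of [B] has [C (h (h' z))] outputs, so the identity output map to [C z] must be a
   cast. *)
pose LR := @DLMap B C h' (fun z => cast_ord (congr1 C (h'K z))).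
exists B, LL, LR; split.
- apply/mxblockP => z x; rewrite mul_dlmap_mxl dlmap_blockE.
  (* Block row [h' z] of [LL] is, by conversion, block row [h (h' z)] of [L]. *)
  apply/esym/(@mul_cast_block R A C L _ _ x (h'K z)) => c b.
  by rewrite mxE dlmap_entry_input_map.
- exists n, erefl; split=> // x i k; rewrite dlmap_blockE.
  have hk : h k = h (tagnat.Rank x i) by rewrite /k cast_ord_id.
  have x_k : x = input_map LL k by rewrite /= hk fh.
  split=> [|x' x'x|i0]; first exact: dlmap_block_stochastic.
    by rewrite dlmap_blockE dlmap_block_neq // -x_k.
  by apply: (dlmap_block_section L'L); rewrite hk h0.
- split; first by exists h.
  by move=> z; exists (congr1 C (h'K z)).
Qed.
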